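(* Let $n\ge 1$. The fusion rules of none of the compact quantum groups $A_{b'}(n)$, $A_{s'}(n)$, $A_c(n)$, $A_p(n)$ can be described by a free fusion ring; that is, for each of these quantum groups there is no fusion set $S$ such that its fusion rules are described by the free fusion ring over $S$.
   Context: A compact matrix quantum group is a pair $(A,U)$ of a unital C*-algebra $A$ and a unitary $U=(u_{ij}) \in M_n(A)$ whose entries generate $A$, such that $\overline U = (u_{ij}^* )$ is invertible and there is a *-homomorphism $\Delta: A \to A\otimes_{\min} A$ with $\Delta(u_{ij}) = \sum_k u_{ik}\otimes u_{kj}$. $\boxtimes$ and $\boxplus$ denote tensor product and direct sum of corepresentations. The following are universal unital C*-algebras generated by self-adjoint elements $u_{ij}$, $1\le i,j\le n$, such that $U=(u_{ij})$ is unitary and subject to the additional relations stated, with fundamental corepresentation $U$: - $A_b(n)$: the $u_{ij}$ sum up to $1$ in every row and every column. - $A_s(n)$: the relations of $A_b(n)$, and the $u_{ij}$ are partial isometries. - $A_{b'}(n)$: the $u_{ij}$ sum up to the same element in every row and every column (one common element for all rows and columns). - $A_{s'}(n)$: the relations of $A_{b'}(n)$, and the $u_{ij}$ are partial isometries. For a compact matrix quantum group $(A,U)$ with $\overline U=U$, the free complexification $\widetilde A$ is the C*-subalgebra of the free product $A*C(S^1)$ generated by the entries of $\widetilde U=(u_{ij}z)$, where $z=\mathrm{id}_{S^1}$ is the canonical generator of $C(S^1)$; its fundamental corepresentation is $\widetilde U$. Put $A_c(n):=\widetilde{A_b(n)}$, $A_p(n):=\widetilde{A_s(n)}$. Fusion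 set: a set $S$ with a fusion $\cdot : S\times S\to S\cup\{\emptyset\}$ and a conjugation $\overline{\phantom{u}}:S\to S$ such that (i) $\cdot$ is associative, with the convention that a product is $\emptyset$ if one of its factors is $\emptyset$; (ii) $\overline{\overline s}=s$; (iii) for all $s_1,s_2,s_3\in S$: $s_1\cdot s_2=\overline{s_3} \Leftrightarrow s_2\cdot s_3=\overline{s_1}$. Let $\mathrm{mon}(S)$ be the free monoid over $S$ (words in $S$). For words $w=w_1\dots w_k$, $w'=w'_1\dots w'_l$ put $\overline w=\overline{w_k}\dots\overline{w_1}$ and $w\cdot w'=w_1\dots w_{k-1}(w_k\cdot w'_1)w'_2\dots w'_l$, which is by convention $\emptyset$ (undefined) if $w_k\cdot w_1'=\emptyset$ or if one of $w,w'$ is the empty word. The fusion rules of a compact quantum group are described by the free fusion ring over $S$ if there is a bijection $w\mapsto U_w$ from $\mathrm{mon}(S)$ onto the set of equivalence classes of irreducible corepresentations such that the empty word corresponds to the trivial corepresentation, $\overline{U_w}\simeq U_{\overline w}$, and $U_w\boxtimes U_{w'}\simeq\sum_{w=xy,\,w'=\overline y t}(U_{xt}\boxplus U_{x\cdot t})$ for all words $w,w'$ (sum over all factorizations, with terms $U_{x\cdot t}$ omitted when $x\cdot t=\emptyset$). *)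

(* Defs.v *)
From HB Require Import structures.
From mathcomp Require Import all_boot all_order all_algebra.
From mathcomp Require Import all_classical all_reals all_analysis.
From mathcomp Require Import complex mxtens.

Set Implicit Arguments.
Unset Strict Implicit.
Unset Printing Implicit Defensive.

Import Order.TTheory GRing.Theory Num.Theory.
Import numFieldNormedType.Exports ComplexField.Normc.

Local Open Scope classical_set_scope.
Local Open Scope ring_scope.
Local Open Scope complex_scope.

(* The metric topology of the complex plane. *)
HB.instance Definition _ (R : rcfType) := PseudoPointedMetric.copy R[i] R[i]^o.

(* Unital C*-algebras.  The complete norm is a plain field of the record, since
   the library hierarchy has no join of algType and completeNormedModType.
   As in any algType, 1 != 0 is part of the structure. *)
Record cstar (R : realType) := Cstar {
  cs_alg :> algType R[i];
  star : cs_alg -> cs_alg;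
  cnorm : cs_alg -> R;
  starZD : forall (a : R[i]) x y,
    star (a *: x + y) = Num.conj a *: star x + star y;
  starM : forall x y, star (x * y) = star y * star x;
  starK : involutive star;
  cnorm0_eq0 : forall x, cnorm x = 0 -> x = 0;
  ler_cnormD : forall x y, cnorm (x + y) <= cnorm x + cnorm y;
  cnormZ : forall (a : R[i]) x, cnorm (a *: x) = normc a * cnorm x;
  ler_cnormM : forall x y, cnorm (x * y) <= cnorm x * cnorm y;
  cnorm_star : forall x, cnorm (star x * x) = cnorm x ^+ 2;
  cnorm_complete : forall u : nat -> cs_alg,
    (forall e : R, 0 < e -> exists N, forall p q, (N <= p)%N -> (N <= q)%N ->
       cnorm (u p - u q) < e) ->
    exists l, (fun p => cnorm (u p - l)) @ \oo --> (0 : R)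
}.

Section CstarAlgebras.
Variable R : realType.
Local Notation C := R[i].

Definition star_hom (A B : cstar R) (f : A -> B) : Prop :=
  [/\ forall (a : C) x y, f (a *: x + y) = a *: f x + f y,
      forall x y, f (x * y) = f x * f y,
      f 1 = 1
    & forall x, f (star x) = star (f x)].

Definition cs_closure (A : cstar R) (B : set A) : set A :=
  [set x | forall e : R, 0 < e -> exists2 y, B y & cnorm (x - y) < e].

Definition cstar_subalgebra (A : cstar R) (B : set A) : Prop :=
  [/\ cs_closure B `<=` B,
      B 1,
      forall (a : C) x y, B x -> B y -> B (a *: x + y),
      forall x y, B x -> B y -> B (x * y)
    & forall x, B x -> B (star x)].

Definition cstar_gen (A : cstar R) (X : set A) : set A :=
  smallest (@cstar_subalgebra A) X.

Definition partial_isometry (A : cstar R) (x : A) : Prop :=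
  x * star x * x = x.

Definition entries (A : cstar R) m (v : 'M[A]_m) : set A :=
  [set x | exists i j, x = v i j].

Definition star_mx (A : cstar R) m (v : 'M[A]_m) : 'M[A]_m :=
  map_mx (@star R A) v.

Definition mx_inverse (A : cstar R) m (v w : 'M[A]_m) : Prop :=
  v *m w = 1%:M /\ w *m v = 1%:M.

Definition mx_invertible (A : cstar R) m (v : 'M[A]_m) : Prop :=
  exists w, mx_inverse v w.

Definition mx_unitary (A : cstar R) m (v : 'M[A]_m) : Prop :=
  mx_inverse v (star_mx v)^T.

Definition bilin (U V W : lmodType C) (b : U -> V -> W) : Prop :=
  (forall y (a : C) x x', b (a *: x + x') y = a *: b x y + b x' y) /\
  (forall x (a : C) y y', b x (a *: y + y') = a *: b x y + b x y').

(* A finite list s of pairs (x, y) stands for the element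
   \sum_((x, y) <- s) x (x) y of the algebraic tensor product of U and V,
   and bilin_sum b s is its image under the linear map induced by b. *)
Definition bilin_sum (U V W : lmodType C) (b : U -> V -> W)
    (s : seq (U * V)) : W :=
  \sum_(p <- s) b p.1 p.2.

(* By the universal property of the algebraic tensor product, this says that s
   represents 0 in it. *)
Definition tens_null (U V : lmodType C) (s : seq (U * V)) : Prop :=
  forall (W : lmodType C) (b : U -> V -> W), bilin b -> bilin_sum b s = 0.

(* T, together with t : (x, y) |-> x (x) y, is the completion of the algebraic
   tensor product of A and B with respect to some C*-norm; the fourth clause is
   injectivity on the algebraic tensor product. *)
Definition cstar_tensor (A B T : cstar R) (t : A -> B -> T) : Prop :=
  [/\ bilin t,
      t 1 1 = 1
        /\ (forall x x' y y', t x y * t x' y' = t (x * x') (y * y')),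
      forall x y, star (t x y) = t (star x) (star y),
      forall s, bilin_sum t s = 0 -> tens_null s
    & cs_closure (range (bilin_sum t)) = setT].

(* The norm of T restricts to the least C*-norm on the algebraic tensor
   product. *)
Definition min_tensor (A B T : cstar R) (t : A -> B -> T) : Prop :=
  cstar_tensor t /\
  forall (T' : cstar R) (t' : A -> B -> T'), cstar_tensor t' ->
    forall s, cnorm (bilin_sum t s) <= cnorm (bilin_sum t' s).

(* The unital free product, i.e. the coproduct of unital C*-algebras. *)
Definition free_product (A B P : cstar R) (i : A -> P) (j : B -> P) : Prop :=
  [/\ star_hom i,
      star_hom j
    & forall (D : cstar R) (f : A -> D) (g : B -> D),
        star_hom f -> star_hom g ->
        exists! h : P -> D,
          [/\ star_hom h, forall x, h (i x) = f x & forall y, h (j y) = g y]].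

Definition circle : set C := [set z | `|z| = 1].

(* ev identifies E with the C*-algebra C(S^1): pointwise operations and the
   supremum norm. *)
Definition circle_algebra (E : cstar R) (ev : E -> circle -> C) : Prop :=
  [/\ injective ev,
      range ev = [set f : circle -> C | continuous f],
      (forall (a : C) f g x, ev (a *: f + g) x = a * ev f x + ev g x)
        /\ (forall f g x, ev (f * g) x = ev f x * ev g x),
      (forall x, ev 1 x = 1) /\ (forall f x, ev (star f) x = Num.conj (ev f x))
    & forall f (c : R), cnorm f <= c <-> forall x, normc (ev f x) <= c].

End CstarAlgebras.
Arguments circle R : clear implicits.

Section QuantumGroups.
Variable R : realType.
Local Notation C := R[i].

(* Compact matrix quantum groups.  The minimal tensor square of the algebra is carried along, since it is only
   determined up to isomorphism. *)
Record cmqg (n : nat) := CMQG {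
  qg_alg :> cstar R;
  qg_fund : 'M[qg_alg]_n;
  qg_unitary : mx_unitary qg_fund;
  qg_gen : cstar_gen (entries qg_fund) = setT;
  qg_conj : mx_invertible (star_mx qg_fund);
  qg_sq : cstar R;
  qg_tens : qg_alg -> qg_alg -> qg_sq;
  qg_min : min_tensor qg_tens;
  qg_delta : qg_alg -> qg_sq;
  qg_delta_hom : star_hom qg_delta;
  qg_delta_fund : forall i j,
    qg_delta (qg_fund i j) = \sum_k qg_tens (qg_fund i k) (qg_fund k j)
}.

Section Corepresentations.
Variables (n : nat) (G : cmqg n).

(* Finite-dimensional (invertible) corepresentation matrices; unitarity is not
   required, so that conjugates are again of this form. *)
Definition corep m (v : 'M[G]_m) : Prop :=
  mx_invertible v /\
  forall i j, qg_delta (v i j) = \sum_k qg_tens (v i k) (v k j).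

Definition scal_mx m p (X : 'M[C]_(m, p)) : 'M[G]_(m, p) :=
  map_mx (fun a : C => a%:A) X.

Definition intertwiner m p (v : 'M[G]_m) (w : 'M[G]_p) (X : 'M[C]_(p, m)) :
    Prop :=
  scal_mx X *m v = w *m scal_mx X.

Definition corep_equiv m p (v : 'M[G]_m) (w : 'M[G]_p) : Prop :=
  exists (X : 'M[C]_(p, m)) (Y : 'M[C]_(m, p)),
    [/\ X *m Y = 1%:M, Y *m X = 1%:M & intertwiner v w X].

Definition irreducible m (v : 'M[G]_m) : Prop :=
  [/\ (0 < m)%N,
      corep v
    & forall X : 'M[C]_m, intertwiner v v X -> is_scalar_mx X].

Definition trivial_corep : 'M[G]_1 := 1%:M.

End Corepresentations.

Definition cstar_rel (n : nat) := forall A : cstar R, 'M[A]_n -> Prop.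

(* (A, u) is the universal unital C*-algebra generated by n^2 elements subject
   to the relations rel. *)
Definition universal n (rel : cstar_rel n) (A : cstar R) (u : 'M[A]_n) :
    Prop :=
  rel A u /\
  forall (B : cstar R) (v : 'M[B]_n), rel B v ->
    exists! f : A -> B, star_hom f /\ forall i j, f (u i j) = v i j.

Definition rel_o n : cstar_rel n := fun A u =>
  (forall i j, star (u i j) = u i j) /\ mx_unitary u.

Definition rel_b n : cstar_rel n := fun A u =>
  [/\ rel_o u, forall i, \sum_j u i j = 1 & forall j, \sum_i u i j = 1].

Definition rel_s n : cstar_rel n := fun A u =>
  rel_b u /\ forall i j, partial_isometry (u i j).

Definition rel_b' n : cstar_rel n := fun A u =>
  rel_o u /\
  exists r : A, (forall i, \sum_j u i j = r) /\ (forall j, \sum_i u i j = r).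

Definition rel_s' n : cstar_rel n := fun A u =>
  rel_b' u /\ forall i j, partial_isometry (u i j).

Definition is_A_b n (G : cmqg n) := universal (@rel_b n) (qg_fund G).
Definition is_A_s n (G : cmqg n) := universal (@rel_s n) (qg_fund G).
Definition is_A_b' n (G : cmqg n) := universal (@rel_b' n) (qg_fund G).
Definition is_A_s' n (G : cmqg n) := universal (@rel_s' n) (qg_fund G).

(* G is the free complexification of H: kappa identifies the algebra of G with
   the C*-subalgebra of H * C(S^1) generated by the u_ij z. *)
Definition free_complexification n (H G : cmqg n) : Prop :=
  star_mx (qg_fund H) = qg_fund H /\
  exists (E P : cstar R) (ev : E -> circle R -> C) (z : E)
         (i : H -> P) (j : E -> P) (kappa : G -> P),
    [/\ circle_algebra ev /\ (forall x : circle R, ev z x = set_val x),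
        free_product i j,
        star_hom kappa /\ injective kappa,
        range kappa =
          cstar_gen (entries (\matrix_(k, l) (i (qg_fund H k l) * j z)))
      & forall k l, kappa (qg_fund G k l) = i (qg_fund H k l) * j z].

Definition is_A_c n (G : cmqg n) :=
  exists H : cmqg n, is_A_b H /\ free_complexification H G.
Definition is_A_p n (G : cmqg n) :=
  exists H : cmqg n, is_A_s H /\ free_complexification H G.

End QuantumGroups.

(* None encodes the value "emptyset" of the fusion. *)
Record fusionSet := FusionSet {
  fs_sort :> Type;
  fs_mul : fs_sort -> fs_sort -> option fs_sort;
  fs_conj : fs_sort -> fs_sort;
  fs_mulA : forall a b c,
    obind (fun ab => fs_mul ab c) (fs_mul a b)
    = obind (fun bc => fs_mul a bc) (fs_mul b c);
  fs_conjK : involutive fs_conj;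
  fs_frob : forall a b c,
    fs_mul a b = Some (fs_conj c) <-> fs_mul b c = Some (fs_conj a)
}.

Section FreeFusionRing.
Variable S : fusionSet.

Definition word_conj (w : seq S) : seq S := rev (map (@fs_conj S) w).

Definition word_mul (w w' : seq S) : option (seq S) :=
  match w, w' with
  | a :: v, b :: v' =>
      omap (fun c => belast a v ++ c :: v') (fs_mul (last a v) b)
  | _, _ => None
  end.

(* The words x t and x . t (if defined), with multiplicity, for all
   factorizations w = x y and w' = word_conj y ++ t.  Such a factorization is
   determined by k = size x. *)
Definition fusion_terms (w w' : seq S) : seq (seq S) :=
  flatten [seq (let x := take k w in
                let y := drop k w in
                let t := drop (size y) w' in
                if `[< w' = word_conj y ++ t >]
                then (x ++ t) :: seq_of_opt (word_mul x t) else [::])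
          | k <- iota 0 (size w).+1].

Variables (R : realType) (n : nat) (G : cmqg R n).

(* V w is a matrix representing the class of irreducible corepresentations
   attached to the word w. *)
Definition free_fusion_rules : Prop :=
  exists (d : seq S -> nat) (V : forall w, 'M[G]_(d w)),
    [/\ [/\ forall w, irreducible (V w),
            forall w w', corep_equiv (V w) (V w') -> w = w'
          & forall m (v : 'M[G]_m), irreducible v ->
              exists w, corep_equiv v (V w)],
        corep_equiv (V [::]) (trivial_corep G),
        forall w, corep_equiv (star_mx (V w)) (V (word_conj w))
      & forall w w',
          let l := fusion_terms w w' in
          corep_equiv (V w *t V w')
            (\mxdiag_(k < size l) V (nth [::] l k))].

End FreeFusionRing.

(* Main.v *)
(** A word [w] over a fusion set labelling a one-dimensional corepresentation
    must be empty: for nonempty [w] the product of [U_w] and its conjugate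
    contains both the trivial corepresentation and [U_(w (conj w))], so it has
    dimension at least 2.  Hence a quantum group with a group-like unitary
    [r != 1] is not described by a free fusion ring.  In all four cases the
    common row sum of the fundamental corepresentation is such an element: for
    [A_b'] and [A_s'] the automorphism [u_ij |-> - u_ij] maps it to its
    opposite, and for the free complexifications it is the generator [z]. *)
Require Import Defs.
From mathcomp Require Import all_boot all_order all_algebra.
From mathcomp Require Import all_classical all_reals all_analysis.
From mathcomp Require Import complex mxtens.

Set Implicit Arguments.
Unset Strict Implicit.
Unset Printing Implicit Defensive.

Import Order.TTheory GRing.Theory Num.Theory.

Local Open Scope ring_scope.
Local Open Scope complex_scope.

(** * Elementary algebra of stars, *-homomorphisms and bilinear maps *)

Section CstarFacts.
Variable R : realType.
Implicit Types A B : cstar R.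

Lemma starD A (x y : A) : star (x + y) = star x + star y.
Proof. by have := starZD 1 x y; rewrite scale1r rmorph1 scale1r. Qed.

Lemma star0 A : star (0 : A) = 0.
Proof. by apply: (addrI (star 0)); rewrite -starD !addr0. Qed.

Lemma star1 A : star (1 : A) = 1.
Proof. by rewrite -[LHS]mulr1 -[X in _ * X]starK -starM mulr1 starK. Qed.

Lemma starZ A (a : R[i]) (x : A) : star (a *: x) = Num.conj a *: star x.
Proof. by rewrite -[a *: x]addr0 starZD star0 addr0. Qed.

Lemma starN A (x : A) : star (- x) = - star x.
Proof. by apply/eqP; rewrite -addr_eq0 -starD addNr star0. Qed.

(** Equality would give [2 *: 1 = 0]; cancelling the invertible scalar 2 contradicts [1 != 0]. *)
Lemma oppr1_neq1 A : (-1 : A) <> 1.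
Proof.
move=> /eqP; rewrite eq_sym -addr_eq0 => /eqP e.
suff /eqP : (1 : A) = 0 by rewrite oner_eq0.
have : (2^-1 : R[i]) *: ((2 : R[i]) *: (1 : A)) = 0.
  by rewrite scaler_nat [X in _ *: X](_ : _ = 0) ?scaler0 // -[RHS]e mulr2n.
by rewrite scalerA mulVf ?scale1r // pnatr_eq0.
Qed.

Section StarHom.
Variables (A B : cstar R) (f : A -> B).
Hypothesis hf : star_hom f.

Lemma star_homD x y : f (x + y) = f x + f y.
Proof. by case: hf => + _ _ _ => /(_ 1 x y); rewrite !scale1r. Qed.

Lemma star_hom0 : f 0 = 0.
Proof. by apply: (addrI (f 0)); rewrite -star_homD !addr0. Qed.

Lemma star_hom_sum I (s : seq I) (F : I -> A) :
  f (\sum_(i <- s) F i) = \sum_(i <- s) f (F i).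
Proof. exact: (big_morph f star_homD star_hom0). Qed.

End StarHom.

Lemma bilin_suml (U V W : lmodType R[i]) (b : U -> V -> W) (hb : bilin b)
    I (s : seq I) (F : I -> U) y :
  b (\sum_(i <- s) F i) y = \sum_(i <- s) b (F i) y.
Proof.
have D x x' : b (x + x') y = b x y + b x' y.
  by have := hb.1 y 1 x x'; rewrite !scale1r.
have b0 : b 0 y = 0 by apply: (addrI (b 0 y)); rewrite -D !addr0.
exact: (big_morph (b^~ y) D b0).
Qed.

Lemma bilin_sumr (U V W : lmodType R[i]) (b : U -> V -> W) (hb : bilin b)
    I (s : seq I) (F : I -> V) x :
  b x (\sum_(i <- s) F i) = \sum_(i <- s) b x (F i).
Proof.
have D y y' : b x (y + y') = b x y + b x y'.
  by have := hb.2 x 1 y y'; rewrite !scale1r.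
have b0 : b x 0 = 0 by apply: (addrI (b x 0)); rewrite -D !addr0.
exact: (big_morph (b x) D b0).
Qed.

End CstarFacts.

(** * Dimension of corepresentations and group-like elements *)

Section OneDimensional.
Variables (R : realType) (n : nat) (G : cmqg R n).

Lemma scal_mxM m p q (X : 'M[R[i]]_(m, p)) (Y : 'M[R[i]]_(p, q)) :
  scal_mx G (X *m Y) = scal_mx G X *m scal_mx G Y.
Proof. exact: (map_mxM (in_alg (cs_alg (qg_alg G)))). Qed.

Lemma corep_equiv_trans m p q (u : 'M[G]_m) (v : 'M[G]_p) (w : 'M[G]_q) :
  corep_equiv u v -> corep_equiv v w -> corep_equiv u w.
Proof.
case=> X [Y [XY YX i1]] [X' [Y' [XY' YX' i2]]].
exists (X' *m X), (Y *m Y'); split.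
- by rewrite mulmxA -(mulmxA X') XY mulmx1.
- by rewrite mulmxA -(mulmxA Y) YX' mulmx1.
by rewrite /intertwiner !scal_mxM -mulmxA i1 mulmxA i2 mulmxA.
Qed.

Lemma corep_equiv_dim m p (v : 'M[G]_m) (w : 'M[G]_p) :
  corep_equiv v w -> m = p.
Proof.
case=> X [Y [XY YX _]].
by apply/eqP; rewrite eqn_leq (mulmx1_min YX) (mulmx1_min XY).
Qed.

Lemma corep_equiv_trivial (r : G) :
  corep_equiv (r%:M : 'M[G]_1) (trivial_corep G) -> r = 1.
Proof.
case=> X [Y [_ YX]]; rewrite /intertwiner /trivial_corep mul1mx => XrX.
have: scal_mx G Y *m (scal_mx G X *m r%:M) = scal_mx G Y *m scal_mx G X.
  by rewrite XrX.
rewrite mulmxA -scal_mxM YX /scal_mx.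
rewrite (map_mx1 (in_alg (cs_alg (qg_alg G)))) mul1mx.
by move/matrixP/(_ 0 0); rewrite !mxE.
Qed.

(** Every 1 x 1 complex matrix is scalar, so only the corepresentation axioms have content. *)
Lemma irreducible_grouplike (r s : G) :
    r * s = 1 -> s * r = 1 -> qg_delta r = qg_tens r r ->
  irreducible (r%:M : 'M[G]_1).
Proof.
move=> rs sr hr; split=> //; last first.
  by move=> X _; apply/is_scalar_mxP; exists (X 0 0); exact: mx11_scalar.
split; first by exists s%:M; rewrite /mx_inverse -!scalar_mxM rs sr.
by move=> i j; rewrite big_ord1 !ord1 !mxE.
Qed.

(** Summing [qg_delta_fund] over [j] first turns each right tensor factor into the sum of row [k],
    which is [r]; the left factors then add up to row [i]. *)
Lemma row_sum_grouplike (r : G) (i : 'I_n) :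
  (forall i, \sum_j qg_fund G i j = r) -> qg_delta r = qg_tens r r.
Proof.
move=> hr; have hb : bilin (@qg_tens R n G) by case: (qg_min G) => -[].
rewrite -{1}(hr i) (star_hom_sum (qg_delta_hom G)).
under eq_bigr => j _ do rewrite qg_delta_fund.
rewrite exchange_big /=.
under eq_bigr => k _ do rewrite -(bilin_sumr hb) hr.
by rewrite -(bilin_suml hb) hr.
Qed.

End OneDimensional.

(** * Counting terms in the free fusion rules *)

Section FreeFusion.
Variable S : fusionSet.

Lemma size_word_conj (w : seq S) : size (word_conj w) = size w.
Proof. by rewrite size_rev size_map. Qed.

(** The cuts [k = 0] and [k = size w], distinct for nonempty [w], contribute the empty word and
    [w ++ word_conj w]. *)
Lemma size_fusion_terms_conj (w : seq S) :
  w <> [::] -> (1 < size (fusion_terms w (word_conj w)))%N.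
Proof.
case: w => // a v _; set w := a :: v; rewrite /fusion_terms.
set F := (X in map X _).
have F0 : (0 < size (F 0%N))%N.
  rewrite /F take0 drop0 drop_oversize ?size_word_conj // cats0.
  by rewrite asboolT.
have Fw : (0 < size (F (size w)))%N.
  rewrite /F take_size drop_size drop0.
  by rewrite asboolT.
have -> : iota 0 (size w).+1 = 0%N :: iota 1 (size v) ++ [:: size w].
  by congr cons; have := iotaD 1 (size v) 1; rewrite addn1 add1n.
rewrite map_cons map_cat -cat1s !flatten_cat !size_cat /=.
(* The terms from the intermediate cuts are discarded. *)
rewrite !addn0 addnCA; apply: leq_trans (leq_addl _ _).
exact: leq_add F0 Fw.
Qed.

Lemma free_fusion_grouplike (R : realType) (n : nat) (G : cmqg R n) (r s : G) :
    free_fusion_rules S G ->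
  r * s = 1 -> s * r = 1 -> qg_delta r = qg_tens r r -> r = 1.
Proof.
move=> [d [V [[irrV _ surjV] V0 Vconj Vmul]]] rs sr hr.
have [w rw] := surjV _ _ (irreducible_grouplike rs sr hr).
have [w0|wN0] := pselect (w = [::]).
  by apply: corep_equiv_trivial; apply: corep_equiv_trans rw _; rewrite w0.
have dw := corep_equiv_dim rw.
have dcw := corep_equiv_dim (Vconj w).
have := corep_equiv_dim (Vmul w (word_conj w)).
rewrite -dcw -dw muln1 => e1.
have := size_fusion_terms_conj wN0.
suff : (size (fusion_terms w (word_conj w)) <= 1)%N by rewrite leqNgt => /negP.
apply: leq_trans (eq_leq (esym e1)).
(* Each summand is irreducible, hence of dimension at least 1, while by [e1] the dimensions add up
   to 1. *)
rewrite -[X in (X <= _)%N]card_ord -sum1_card.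
apply: leq_sum => k _.
by case: (irrV (nth [::] (fusion_terms w (word_conj w)) k)).
Qed.

End FreeFusion.

(** * Nontrivial group-like elements in the four families *)

Section Cases.
Variables (R : realType) (n : nat) (G : cmqg R n).
Hypothesis hn : (1 <= n)%N.

(** Expanding one [r] along row [i] and the other along column [k] gives the sum over [j] of the
    entries [(i, j)] of [u *m u^T], which is the identity since [u] is unitary with self-adjoint
    entries. *)
Lemma rel_b'_sum_sq (A : cstar R) (u : 'M[A]_n) (r : A) :
    rel_o u -> (forall i, \sum_j u i j = r) ->
    (forall j, \sum_i u i j = r) ->
  r * r = 1.
Proof.
move=> [sa [uu _]] hrow hcol; pose i := Ordinal hn.
rewrite -{1}(hrow i) mulr_suml.
have -> : \sum_j u i j * r = \sum_k \sum_j u i k * u j k.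
  by apply: eq_bigr => k _; rewrite -(hcol k) mulr_sumr.
rewrite exchange_big /= (bigD1 i) //= [X in _ + X]big1 => [|j ji].
  have /matrixP/(_ i i) := uu; rewrite !mxE eqxx mulr1n addr0 => e1.
  rewrite -[RHS]e1.
  by apply: eq_bigr => k _; rewrite !mxE sa.
have /matrixP/(_ i j) := uu; rewrite !mxE eq_sym (negPf ji) mulr0n => e0.
rewrite -[RHS]e0.
by apply: eq_bigr => k _; rewrite !mxE sa.
Qed.

Lemma rel_b'N (A : cstar R) (u : 'M[A]_n) : rel_b' u -> rel_b' (- u).
Proof.
move=> [[sa [uu uu']] [r [hrow hcol]]]; split; last first.
  exists (- r); split=> k; under eq_bigr => l _ do rewrite !mxE.
    by rewrite sumrN hrow.
  by rewrite sumrN hcol.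
have e : (star_mx (- u))^T = - (star_mx u)^T.
  by apply/matrixP => i j; rewrite !mxE starN.
split; first by move=> i j; rewrite !mxE starN sa.
by rewrite /mx_unitary e; split; rewrite mulNmx mulmxN opprK.
Qed.

Lemma rel_s'N (A : cstar R) (u : 'M[A]_n) : rel_s' u -> rel_s' (- u).
Proof.
move=> [hb pi]; split; first exact: rel_b'N.
by move=> i j; rewrite /partial_isometry !mxE starN mulrNN mulrN pi.
Qed.

(** The *-homomorphism negating the generators sends [r] to [- r] but fixes 1. *)
Lemma universal_sum_neq1 (rel : cstar_rel R n) (r : G) :
    universal rel (qg_fund G) -> rel G (- qg_fund G) ->
  (forall i, \sum_j qg_fund G i j = r) -> r <> 1.
Proof.
move=> [_ univ] relN hrow r1.
have [f [[hf fu] _]] := univ _ _ relN.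
have f1 : f 1 = 1 by case: hf.
have : f r = - r.
  rewrite -(hrow (Ordinal hn)) (star_hom_sum hf) -sumrN.
  by apply: eq_bigr => j _; rewrite fu mxE.
by rewrite r1 f1 => /esym /oppr1_neq1.
Qed.

Lemma grouplike_of_b' (rel : cstar_rel R n) :
    universal rel (qg_fund G) -> rel_b' (qg_fund G) ->
    rel G (- qg_fund G) ->
  exists r s : G, [/\ r * s = 1, s * r = 1, qg_delta r = qg_tens r r & r <> 1].
Proof.
move=> univ [ho [r [hrow hcol]]] relN.
have rr := rel_b'_sum_sq ho hrow hcol.
exists r, r; split=> //; first exact: row_sum_grouplike (Ordinal hn) hrow.
exact: universal_sum_neq1 univ relN hrow.
Qed.

(** Since the rows of [H] sum to 1, [kappa] sends every row sum of [G] to [j z]. Injectivity of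
    [kappa] makes these sums equal and pulls the unitarity of [z] back to [G]. *)
Lemma grouplike_of_free_complexification (H : cmqg R n) :
    (forall i, \sum_j qg_fund H i j = 1) -> free_complexification H G ->
  exists r s : G, [/\ r * s = 1, s * r = 1, qg_delta r = qg_tens r r & r <> 1].
Proof.
move=> hrow [_ [E [P [ev [z [i [j [kappa]]]]]]]].
move=> [[[evI _ [evL evM] [ev1 evS] _] evz] [hi hj fpP] [hk kI] _ ku].
have kr k : kappa (\sum_l qg_fund G k l) = j z.
  rewrite (star_hom_sum hk).
  under eq_bigr => l _ do rewrite ku.
  rewrite -mulr_suml -(star_hom_sum hi) hrow.
  by case: hi => _ _ -> _; rewrite mul1r.
have zz : z * star z = 1 /\ star z * z = 1.
  have zU (x : circle R) : ev z x * Num.conj (ev z x) = 1.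
    have := set_valP x; rewrite /circle /= => nx.
    by rewrite evz -normCK nx expr1n.
  by split; apply/evI/funext => x; rewrite evM evS ev1 // mulrC zU.
pose r := \sum_l qg_fund G (Ordinal hn) l.
have hr k : \sum_l qg_fund G k l = r by apply: kI; rewrite !kr.
case: hj (hj) (hk) => [jL jM j1 jS] hj [kL kM k1 kS].
exists r, (star r); split.
- by apply: kI; rewrite kM kS k1 kr -jS -jM zz.1.
- by apply: kI; rewrite kM kS k1 kr -jS -jM zz.2.
- exact: row_sum_grouplike (Ordinal hn) hr.
move=> r1.
have m1 : (-1 : R[i]) \in circle R by rewrite inE /circle /= normrN1.
pose x : circle R := exist _ (-1) m1.
(* Evaluation at -1 on C(S^1), extended by the identity of the algebra of H. *)
pose g (f : E) : H := (ev f x)%:A.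
have hg : star_hom g.
  split; rewrite /g.
  - by move=> a f f'; rewrite evL scalerDl scalerA.
  - by move=> f f'; rewrite evM -scalerAl mul1r scalerA.
  - by rewrite ev1 scale1r.
  - by move=> f; rewrite evS starZ star1.
have hid : star_hom (@id H) by [].
have [h [[[hL hM h1 hS] _ hjg] _]] := fpP _ _ _ hid hg.
(* If [r = 1] then [j z = 1], so [h (j z) = 1], whereas [g z = -1]. *)
have := hjg z; rewrite -(kr (Ordinal hn)) -/r r1 k1 h1 /g evz /= scaleN1r.
by move/esym/oppr1_neq1.
Qed.

End Cases.

Theorem mainTheorem4 (R : realType) (n : nat) (hn : (1 <= n)%N)
    (G : cmqg R n)
    (hG : is_A_b' G \/ is_A_s' G \/ is_A_c G \/ is_A_p G) :
  ~ exists S : fusionSet, free_fusion_rules S G.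
Proof.
move=> [S ff].
suff [r [s [rs sr hr]]] : exists r s : G,
    [/\ r * s = 1, s * r = 1, qg_delta r = qg_tens r r & r <> 1].
  by apply; exact: free_fusion_grouplike ff rs sr hr.
case: hG => [hb|[hs|[[H [[[_ hrow _] _] fc]]|[H [[[[_ hrow _] _] _] fc]]]]].
- have hrel := hb.1.
  exact: (grouplike_of_b' hn hb hrel (rel_b'N hrel)).
- have hrel := hs.1.
  exact: (grouplike_of_b' hn hs hrel.1 (rel_s'N hrel)).
- exact: grouplike_of_free_complexification hn _ hrow fc.
- exact: grouplike_of_free_complexification hn _ hrow fc.
Qed.
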